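(* For a topological space $(X,\tau)$ the following conditions are equivalent: (1) $X$ is a semi-$T_1$-space; (2) every locally dense subset of $X$ is a $V_s$-set; (3) every $\beta$-open subset of $X$ is a $V_s$-set.
   Context: Let $(X,\tau)$ be a topological space. A subset $A\subseteq X$ is semi-open if there is $O\in\tau$ with $O\subseteq A\subseteq \mathrm{Cl}(O)$; a subset is semi-closed if its complement is semi-open. For $B\subseteq X$, $B^{V_s}=\bigcup\{F : F\subseteq B,\ F \text{ semi-closed}\}$, and $B$ is a $V_s$-set (as a subset of $X$) if $B=B^{V_s}$. A subset $A$ is locally dense (also called preopen) if $A\subseteq \mathrm{Int}(\mathrm{Cl}(A))$. A subset $A$ is $\beta$-open (also called semi-preopen, or a $\beta$-set) if it is a dense subset of some regular closed subspace of $X$. The space $(X,\tau)$ is a semi-$T_1$-space if for each pair of distinct points $x,y\in X$ there is a semi-open set containing $x$ but not $y$ and a semi-open set containing $y$ but not $x$ (equivalently, every singleton is semi-closed). *)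

(* Defs.v *)
From mathcomp Require Import all_boot.
From mathcomp Require Import all_classical all_reals all_analysis.

Set Implicit Arguments.
Unset Strict Implicit.
Unset Printing Implicit Defensive.

Local Open Scope classical_set_scope.

Section GeneralizedOpenSets.
Context {X : topologicalType}.
Implicit Types A B : set X.

Definition semi_open A :=
  exists O : set X, [/\ open O, O `<=` A & A `<=` closure O].

Definition semi_closed A := semi_open (~` A).

Definition Vs_kernel B : set X :=
  \bigcup_(F in [set F : set X | F `<=` B /\ semi_closed F]) F.

Definition Vs_set B := B = Vs_kernel B.

Definition locally_dense A := A `<=` interior (closure A).

(* [R] coerces to the subtype [set_type R], whose topology is the one induced
   by [set_val : R -> X]. The library's [subspace R] would not do here: it keeps
   the points outside [R], as isolated points. *)
Definition dense_in_subspace R A :=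
  A `<=` R /\ dense (set_val @^-1` A : set R).

Definition beta_open A :=
  exists R : set X, regclosed R /\ dense_in_subspace R A.

End GeneralizedOpenSets.

Definition semi_T1_space (X : topologicalType) :=
  forall x y : X, x <> y ->
    (exists U : set X, [/\ semi_open U, U x & ~ U y]) /\
    (exists V : set X, [/\ semi_open V, V y & ~ V x]).

(* Main.v *)
(** A singleton is either locally dense or nowhere dense, and a nowhere dense
    set is semi-closed.  A singleton which is a [Vs_set] is semi-closed, so (2)
    makes all singletons semi-closed, which is condition (1) and makes every
    subset a [Vs_set].  Since a locally dense [A] is dense in the regular closed
    set [closure A], (3) implies (2). *)
Require Import Defs.
From mathcomp Require Import all_boot.
From mathcomp Require Import all_classical all_reals all_analysis.

Set Implicit Arguments.
Unset Strict Implicit.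
Unset Printing Implicit Defensive.

Local Open Scope classical_set_scope.

Section SemiClosedSingletons.
Context {X : topologicalType}.
Implicit Types (A : set X) (x : X).

(** The interior of the union contains every open witness [V] of every [F i], so its closure
    contains each [F i]. *)
Lemma semi_open_bigcup (I : Type) (D : set I) (F : I -> set X) :
  (forall i, D i -> semi_open (F i)) -> semi_open (\bigcup_(i in D) F i).
Proof.
move=> soF; exists (interior (\bigcup_(i in D) F i)); split.
- exact: open_interior.
- exact: interior_subset.
- move=> x [i Di Fix]; have [V [openV VF FV]] := soF i Di.
  apply: closureS (FV x Fix) => z Vz; apply: (interiorS (A := V)).
    by move=> w Vw; exists i => //; exact: VF.
  by rewrite ((interior_id V).1 openV).
Qed.

Lemma semi_T1_spaceP :
  semi_T1_space X <-> forall x, semi_closed [set x].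
Proof.
split=> [T1 x|sc x y xy].
- rewrite /semi_closed.
  (* Separation covers the complement of [x] by semi-open sets missing [x], and semi-openness is
     stable under unions. *)
  have -> : ~` [set x] =
      \bigcup_(U in [set U : set X | semi_open U /\ ~ U x]) U.
    apply/seteqP; split=> [y /= yx|y [U [_ Ux] Uy] /= yx].
      by have [[U [soU Uy Ux]] _] := T1 y x yx; exists U.
    by rewrite yx in Uy.
  by apply: semi_open_bigcup => U [].
- split; [exists (~` [set y])|exists (~` [set x])]; split.
  + exact: sc.
  + exact: xy.
  + by move=> /(_ erefl).
  + exact: sc.
  + by move=> /= yx; exact: xy.
  + by move=> /(_ erefl).
Qed.

(** Every set is the union of its singletons. *)
Lemma semi_closed1_Vs_set A : (forall x, semi_closed [set x]) -> Vs_set A.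
Proof.
move=> sc; apply/seteqP; split=> [x Ax|x [F [FA _] Fx]]; last exact: FA.
by exists [set x] => //; split=> // y ->.
Qed.

Lemma Vs_set1_semi_closed x : Vs_set [set x] -> semi_closed [set x].
Proof.
move=> Vx; have [F [Fx scF] xF] : Vs_kernel [set x] x by rewrite -Vx.
by rewrite (_ : [set x] = F)//; apply/seteqP; split=> // y ->.
Qed.

(** The complement of [closure A] is open, and it is dense because the closure of a complement is
    the complement of the interior. *)
Lemma nowhere_dense_semi_closed A :
  interior (closure A) = set0 -> semi_closed A.
Proof.
move=> A0; exists (~` closure A); split.
- exact/closed_openC/closed_closure.
- exact/subsetC/subset_closure.
- by rewrite closure_setC A0 setC0.
Qed.

Lemma locally_dense1_or_nowhere_dense x :
  locally_dense [set x] \/ interior (closure [set x]) = set0.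
Proof.
have [->|/set0P[y yx]] := eqVneq (interior (closure [set x])) set0.
  by right.
left=> _ ->.
(* The interior is a neighbourhood of [y], which lies in the closure of [x]; hence it contains
   [x]. *)
have /(_ _ (open_nbhs_nbhs (conj (open_interior _) yx))) := interior_subset yx.
by case=> z [/= -> ].
Qed.

Lemma locally_dense_Vs_set_semi_closed1 :
  (forall A, locally_dense A -> Vs_set A) -> forall x, semi_closed [set x].
Proof.
move=> ldV x; have [ldx|ndx] := locally_dense1_or_nowhere_dense x.
  exact/Vs_set1_semi_closed/ldV.
exact: nowhere_dense_semi_closed.
Qed.

Lemma locally_dense_beta_open A : locally_dense A -> beta_open A.
Proof.
move=> ldA; exists (closure A); split.
(* Taking closures in [ldA] gives the inclusion of [closure A] in the closure of its interior. *)
- apply/seteqP; split; last exact: closureS.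
  rewrite [X in _ `<=` X]((closure_id _).1 (@closed_closure _ A)).
  by apply: closureS; exact: interior_subset.
- split; first exact: subset_closure.
  (* [W] is the trace of an open [U] of [X]; as [y] lies in [closure A], [U] meets [A]. *)
  move=> W [y Wy] [U openU UW]; move: Wy; rewrite -UW => Uy.
  have /(_ _ (open_nbhs_nbhs (conj openU Uy))) [z [Az Uz]] := set_valP y.
  by exists (SigSub (mem_set (subset_closure Az))).
Qed.

End SemiClosedSingletons.

Theorem theorem3p10 (X : topologicalType) :
  [<-> semi_T1_space X;
       forall A : set X, locally_dense A -> Vs_set A;
       forall A : set X, beta_open A -> Vs_set A].
Proof.
tfae.
- by move=> /semi_T1_spaceP sc A _; exact: semi_closed1_Vs_set.
- by move=> /locally_dense_Vs_set_semi_closed1 sc A _; exact: semi_closed1_Vs_set.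
- move=> bV; apply/semi_T1_spaceP/locally_dense_Vs_set_semi_closed1 => A.
  by move=> /locally_dense_beta_open; exact: bV.
Qed.
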